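(* Let $1\le m\le n$ be integers. For an $n\times m$ real matrix $A$ let $\overline{A}=\begin{pmatrix}A\\ W_0\end{pmatrix}\in\mathbb{R}^{(m+n)\times m}$, where $W_0=(w_{ij})_{i,j=1}^m$ with $w_{ij}=(-1)^{i+1}$ if $j=m-i+1$ and $w_{ij}=0$ otherwise. Consider a finite collection of quadruples $(P_1,Q_1,P_2,Q_2)$ with $P_i\subseteq[n]$, $Q_i\subseteq[m]$, $|P_i|=|Q_i|$ ($i=1,2$), and real numbers $c_{P_1,Q_1,P_2,Q_2}=c_{I,J}$, where \[I=P_1\cup\{m+n+1-j: j\in[m]\setminus Q_1\},\qquad J=P_2\cup\{m+n+1-j: j\in[m]\setminus Q_2\}.\] Then the following are equivalent: (1) $\sum_{P_1,Q_1,P_2,Q_2} c_{P_1,Q_1,P_2,Q_2}\det A_{P_1,Q_1}\det A_{P_2,Q_2}\ge 0$ for all $n\times m$ totally nonnegative matrices $A$; (2) $\sum_{I,J}c_{I,J}\Delta_I(\overline{A})\Delta_J(\overline{A})\ge0$ for all $n\times m$ totally nonnegative matrices $A$; (3) $\sum_{I,J}c_{I,J}\Delta_I\Delta_J\ge 0$ over $\mathrm{Gr}^{\ge0}(m,m+n)$.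
   Context: A real matrix is totally nonnegative (TNN) if all its minors are $\ge 0$. $A_{P,Q}$ is the submatrix of $A$ with rows in $P$ and columns in $Q$ (in increasing order), and $\det A_{\emptyset,\emptyset}=1$. For $X\in\mathbb{R}^{(m+n)\times m}$ and an $m$-element set $I\subseteq[m+n]$, $\Delta_I(X)$ is the determinant of the $m\times m$ submatrix of $X$ with rows in $I$ (increasing order). $\mathrm{Gr}(m,m+n)$ is the set of $m$-dimensional subspaces of $\mathbb{R}^{m+n}$, each represented by a full-rank matrix $X\in\mathbb{R}^{(m+n)\times m}$; $\mathrm{Gr}^{\ge0}(m,m+n)$ consists of the subspaces having a representative all of whose maximal minors are $\ge0$. An expression $\sum c_{I,J}\Delta_I\Delta_J$ is $\ge 0$ over $\mathrm{Gr}^{\ge0}(m,m+n)$ if $\sum c_{I,J}\Delta_I(X)\Delta_J(X)\ge0$ for every $V\in\mathrm{Gr}^{\ge0}(m,m+n)$ and every representative matrix $X$ of $V$. *)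

(* Defs.v *)
From mathcomp Require Import all_boot all_order all_algebra.
From mathcomp Require Import reals.
Set Implicit Arguments.
Unset Strict Implicit.
Unset Printing Implicit Defensive.
Import Order.TTheory GRing.Theory Num.Theory.
Local Open Scope ring_scope.

(* [enum_val] lists a set of ordinals in increasing order.  When the sizes of  *)
(* [P] and [Q] differ there is no minor; the value 0 is a junk default.        *)
Definition minor (R : realType) (p q : nat) (A : 'M[R]_(p, q))
    (P : {set 'I_p}) (Q : {set 'I_q}) : R :=
  if #|P| =P #|Q| is ReflectT eqPQ
  then \det (mxsub (enum_val (A := mem P))
                   (fun j => enum_val (A := mem Q) (cast_ord eqPQ j)) A)
  else 0.

Definition totally_nonneg (R : realType) (p q : nat) (A : 'M[R]_(p, q)) : Prop :=
  forall (P : {set 'I_p}) (Q : {set 'I_q}), #|P| = #|Q| -> 0 <= minor A P Q.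

Definition plucker (R : realType) (p m : nat) (I : {set 'I_p})
    (X : 'M[R]_(p, m)) : R :=
  minor X I [set: 'I_m].

Definition represents (R : realType) (p m : nat) (X : 'M[R]_(p, m))
    (V : {vspace 'cV[R]_p}) : Prop :=
  \rank X = m /\ V = <<[seq col j X | j : 'I_m]>>%VS.

Definition Gr (R : realType) (m p : nat) (V : {vspace 'cV[R]_p}) : Prop :=
  \dim V = m.

Definition Gr_ge0 (R : realType) (m p : nat) (V : {vspace 'cV[R]_p}) : Prop :=
  Gr m V /\
  exists X : 'M[R]_(p, m), represents X V /\
    forall I : {set 'I_p}, #|I| = m -> 0 <= plucker I X.

(* With 0-based indices, j = m - i + 1 becomes j = rev_ord i, and the sign     *)
(* (-1)^(i + 1) becomes (-1)^i.                                                *)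
Definition W0 (R : realType) (m : nat) : 'M[R]_m :=
  \matrix_(i, j) (if j == rev_ord i then (-1) ^+ i else 0).

Definition bar (R : realType) (n m : nat) (A : 'M[R]_(n, m)) : 'M[R]_(n + m, m) :=
  col_mx A (W0 R m).

(* P U {m + n + 1 - j : j in [m] \ Q}: the 1-based row m + n + 1 - j is the    *)
(* 0-based row n + (m - 1 - j) for the 0-based j, that is rshift n (rev_ord j) *)
Definition rows_of (n m : nat) (PQ : {set 'I_n} * {set 'I_m}) : {set 'I_(n + m)} :=
  [set lshift m i | i in PQ.1] :|: [set rshift n (rev_ord j) | j in ~: PQ.2].

(* Main.v *)
Require Import Defs.
From mathcomp Require Import all_boot all_order all_algebra.
From mathcomp Require Import reals.
From mathcomp Require Import ring lra zify.
Set Implicit Arguments.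
Unset Strict Implicit.
Unset Printing Implicit Defensive.
Import Order.TTheory GRing.Theory Num.Theory.
Local Open Scope ring_scope.

(** Expanding along the rows coming from [W0] gives
    Delta_{rows_of (P, Q)} (bar A) = det A_{P,Q}, so (1) and (2) are the same
    inequality and [bar A] represents a point of Gr^{>=0}, whence (3) => (2).

    Conversely, changing the representative multiplies the form by a square, so
    it suffices to treat X with nonnegative Plucker coordinates.  If the bottom
    coordinate is positive, then X = bar A * g with A totally nonnegative and
    det g > 0.  Otherwise, adding e times row i to row i+1 (e > 0) keeps all
    coordinates nonnegative and turns a positive coordinate I containing i but
    not i+1 into a positive coordinate with i replaced by i+1; repeating this
    reaches the bottom coordinate, and each step is undone by letting e -> 0. *)

(** * Increasing maps between ordinals and enumerations of sets *)

Definition increasing (k p : nat) (f : 'I_k -> 'I_p) : Prop :=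
  forall i j : 'I_k, (i < j)%N -> (f i < f j)%N.

Lemma increasing_inj k p (f : 'I_k -> 'I_p) : increasing f -> injective f.
Proof.
move=> f_incr i j fij; apply: val_inj => /=.
by case: (ltngtP i j) => // /f_incr; rewrite fij ltnn.
Qed.

Lemma sorted_enum_ord p (P : {set 'I_p}) :
  sorted (fun i j : 'I_p => (i < j)%N) (enum P).
Proof.
apply: sorted_filter => [? ? ?|]; first exact: ltn_trans.
by have := iota_ltn_sorted 0 p; rewrite -val_enum_ord sorted_map enumT.
Qed.

(** Two strictly sorted lists with the same members coincide. *)
Lemma enum_increasing k p (f : 'I_k -> 'I_p) :
  increasing f -> enum [set f i | i : 'I_k] = codom f.
Proof.
move=> f_incr; have tr : transitive (fun i j : 'I_p => (i < j)%N).
  by move=> ? ? ?; apply: ltn_trans.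
apply: (irr_sorted_eq tr) => [i||| i]; first exact: ltnn.
- exact: sorted_enum_ord.
- rewrite /codom /image_mem enumT -enum_setT.
  by apply: homo_sorted (sorted_enum_ord _) => i j; apply: f_incr.
by rewrite mem_enum; apply/imsetP/codomP => [[x _ ->]|[x ->]]; exists x.
Qed.

Lemma enum_val_increasing k p (f : 'I_k -> 'I_p) (P : {set 'I_p})
    (cardP : #|P| = k) (i : 'I_#|P|) :
  increasing f -> P = [set f j | j : 'I_k] ->
  enum_val i = f (cast_ord cardP i).
Proof.
move=> f_incr defP.
have iP : (i < size (enum 'I_k))%N by rewrite size_enum_ord -[X in (_ < X)%N]cardP ltn_ord.
rewrite /enum_val; have -> : enum P = codom f by rewrite defP enum_increasing.
rewrite (nth_map (cast_ord cardP i)) //; congr f; apply: val_inj.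
by rewrite /= nth_enum_ord // -[X in (_ < X)%N]cardP ltn_ord.
Qed.

Lemma exists_increasing k p (P : {set 'I_p}) :
  #|P| = k -> exists2 f : 'I_k -> 'I_p, increasing f & P = [set f i | i : 'I_k].
Proof.
move=> <-; exists (fun i => enum_val i) => [i j ltij|].
  have sz a : (a < #|P|)%N -> (a < size (enum P))%N by rewrite cardE.
  rewrite (enum_val_nth (enum_val i)) [X in (_ < val X)%N](enum_val_nth (enum_val i)).
  have tr : transitive (fun i j : 'I_p => (i < j)%N).
    by move=> ? ? ?; apply: ltn_trans.
  apply: (sorted_ltn_nth tr) => //; rewrite ?inE ?sz //.
  exact: sorted_enum_ord.
apply/setP=> x; apply/idP/imsetP => [xP|[i _ ->]]; last exact: enum_valP.
by exists (enum_rank_in xP x); rewrite ?enum_rankK_in.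
Qed.

Lemma rev_ltn p (i j : 'I_p) : (i < j)%N -> (p - j.+1 < p - i.+1)%N.
Proof. by move=> ltij; apply: ltn_sub2l; rewrite ?ltnS // (leq_trans _ (ltn_ord j)). Qed.

(** * Minors along increasing maps *)

Section Minors.
Variable R : realType.

(** Trades the [enum_val] and the cast in [minor] for arbitrary increasing parametrizations; later
    determinant computations rest on this form. *)
Lemma minor_increasing k p q (A : 'M[R]_(p, q)) (f : 'I_k -> 'I_p)
    (g : 'I_k -> 'I_q) :
  increasing f -> increasing g ->
  minor A [set f i | i : 'I_k] [set g i | i : 'I_k] = \det (mxsub f g A).
Proof.
move=> f_incr g_incr; rewrite /minor.
have castE k' (e : k' = k) :
    \det (mxsub (f \o cast_ord e) (g \o cast_ord e) A) = \det (mxsub f g A).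
  by subst k'; congr (\det _); apply/matrixP=> i j; rewrite !mxE /= !cast_ord_id.
have cardf : #|[set f i | i : 'I_k]| = k.
  by rewrite card_imset ?card_ord //; apply: increasing_inj.
have cardg : #|[set g i | i : 'I_k]| = k.
  by rewrite card_imset ?card_ord //; apply: increasing_inj.
case: eqP => [e|]; last by rewrite cardf cardg.
have -> : mxsub (enum_val (A := mem [set f i | i : 'I_k]))
    (fun j => enum_val (A := mem [set g i | i : 'I_k]) (cast_ord e j)) A =
    mxsub (f \o cast_ord cardf) (g \o cast_ord cardf) A.
  apply/matrixP=> i j; rewrite !mxE /=.
  rewrite (enum_val_increasing cardf _ f_incr erefl).
  rewrite (enum_val_increasing cardg _ g_incr erefl).
  by congr (A _ (g _)); apply: val_inj.
exact: castE.
Qed.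

Lemma plucker_increasing p m (X : 'M[R]_(p, m)) (f : 'I_m -> 'I_p) :
  increasing f -> plucker [set f i | i : 'I_m] X = \det (rowsub f X).
Proof.
move=> f_incr; rewrite /plucker -(@minor_increasing _ _ _ X f id) //.
by congr minor; apply/setP=> i; rewrite inE; apply/esym/imsetP; exists i.
Qed.

Lemma pluckerM p m (X : 'M[R]_(p, m)) (g : 'M[R]_m) (I : {set 'I_p}) :
  #|I| = m -> plucker I (X *m g) = plucker I X * \det g.
Proof.
move=> /exists_increasing[f f_incr ->]; rewrite !plucker_increasing //.
by rewrite -det_mulmx mul_rowsub_mx.
Qed.

(** By injectivity the image of [f] is everything, and [f] and the identity are then two increasing
    enumerations of the same set. *)
Lemma increasing_id k (f : 'I_k -> 'I_k) : increasing f -> f =1 id.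
Proof.
move=> f_incr i.
have f_surj : [set f i | i : 'I_k] = [set: 'I_k].
  apply/eqP; rewrite eqEcard subsetT cardsT card_imset ?leqnn //.
  exact: increasing_inj.
have c : #|[set: 'I_k]| = k by rewrite cardsT card_ord.
have id_surj : [set: 'I_k] = [set id i | i : 'I_k].
  by apply/setP=> j; rewrite inE; apply/esym/imsetP; exists j.
have := enum_val_increasing c (cast_ord (esym c) i) f_incr (esym f_surj).
by rewrite (enum_val_increasing c _ _ id_surj) // cast_ordKV => <-.
Qed.

(** * Plücker coordinates of [bar A] *)

(* Laplace expansion along the last row: the sign of its entry cancels that of
   the cofactor, and the remaining rows keep their shape in the smaller matrix. *)
Lemma det_signed_unit_rows l : forall (k m : nat) (M : 'M[R]_m)
    (h g : 'I_k -> 'I_m) (q : 'I_l -> 'I_m), m = (k + l)%N ->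
  (forall i, h i = i :> nat) -> increasing g ->
  (forall s t : 'I_l, (s < t)%N -> (q t < q s)%N) ->
  (forall i t, g i != q t) ->
  (forall (t : 'I_l) (i j : 'I_m), i = (k + t)%N :> nat ->
     M i j = (-1) ^+ (m.-1 - q t) *+ (j == q t)) ->
  \det M = \det (mxsub h g M).
Proof.
elim: l => [|l IHl] k m M h g q.
  rewrite addn0 => def_m; subst m => h_id g_incr _ _ _.
  congr (\det _); apply/matrixP=> i j; rewrite mxE (increasing_id g_incr).
  by congr (M _ _); apply: val_inj; rewrite /= h_id.
rewrite addnS => def_m; subst m => h_id g_incr q_decr gq Mq.
set j0 := q ord_max.
have Mlast j : M ord_max j = (-1) ^+ (k + l - j0) *+ (j == j0) by apply: Mq.
rewrite (expand_det_row M ord_max) (bigD1 j0) //= big1 ?addr0; last first.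
  by move=> j /negPf nj; rewrite Mlast nj mulr0n mul0r.
rewrite Mlast eqxx mulr1n /cofactor mulrA -exprD.
have -> : (-1) ^+ (k + l - j0 + (k + l + j0)) = 1 :> R.
  rewrite -signr_odd; have -> : odd (k + l - j0 + (k + l + j0)) = false.
    by have := ltn_ord j0; lia.
  by [].
rewrite mul1r.
have lift_ltn (a b : 'I_(k + l)) : (lift j0 a < lift j0 b)%N = (a < b)%N.
  by rewrite /= !ltnNge leq_bump2.
have /fin_all_exists[h' hh'] i : exists i', h i = lift ord_max i'.
  case: (unliftP ord_max (h i)) => [i' ->|e]; first by exists i'.
  by have := ltn_ord i; rewrite -h_id e /=; lia.
have /fin_all_exists[g' gg'] i : exists j', g i = lift j0 j'.
  case: (unliftP j0 (g i)) => [j' ->|e]; first by exists j'.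
  by have := gq i ord_max; rewrite e eqxx.
(* As [q] decreases, the deleted column [j0] lies to the left of all remaining columns [q t]. *)
have q_wide (t : 'I_l) : (j0 < q (widen_ord (leqnSn l) t))%N.
  by apply: q_decr; rewrite /= ltn_ord.
have /fin_all_exists[q' qq'] t : exists j', q (widen_ord (leqnSn l) t) = lift j0 j'.
  case: (unliftP j0 (q (widen_ord (leqnSn l) t))) => [j' ->|e]; first by exists j'.
  by have := q_wide t; rewrite e ltnn.
rewrite (IHl k (k + l)%N _ h' g' q') //.
- by congr (\det _); apply/matrixP=> i j; rewrite !mxE hh' gg'.
- by move=> i; rewrite -h_id hh' lift_max.
- by move=> i j ltij; rewrite -lift_ltn -!gg'; apply: g_incr.
- by move=> s t ltst; rewrite -lift_ltn -!qq'; apply: q_decr.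
- by move=> i t; rewrite -(inj_eq (@lift_inj _ j0)) -gg' -qq'.
move=> t i j def_i; rewrite !mxE (Mq (widen_ord (leqnSn l) t)); last first.
  by rewrite lift_max.
rewrite qq' (inj_eq (@lift_inj _ j0)); congr (_ ^+ _ *+ _).
(* Deleting [j0] lowers both the column index [q t] and the last index [m.-1] by one, so the
   exponent [m.-1 - q t] is unchanged. *)
have := q_wide t; rewrite qq' /= /bump; case: leqP => /=; lia.
Qed.

Lemma card_rows_of n m (P : {set 'I_n}) (Q : {set 'I_m}) :
  #|P| = #|Q| -> #|rows_of (P, Q)| = m.
Proof.
move=> eqPQ; rewrite cardsU /= (card_imset _ (@lshift_inj _ _)).
rewrite card_imset => [|x y /(@rshift_inj _ _)/rev_ord_inj //].
rewrite eqPQ cardsC card_ord -[RHS]subn0; congr subn.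
apply/eqP; rewrite cards_eq0; apply/eqP/setP=> x; rewrite !inE.
apply/negP=> /andP[/imsetP[a _ ->] /imsetP[b _ /eqP]].
by rewrite eq_lrshift.
Qed.

(** The chosen rows of [W0] are signed unit vectors supported on the columns outside [Q]. Expanding
    along them deletes exactly these columns and leaves the rows in [P] and the columns in [Q]. *)
Lemma plucker_rows_of n m (A : 'M[R]_(n, m)) (P : {set 'I_n}) (Q : {set 'I_m}) :
  #|P| = #|Q| -> plucker (rows_of (P, Q)) (bar A) = minor A P Q.
Proof.
move=> eqPQ.
have [f f_incr defP] := exists_increasing eqPQ.
have [g g_incr defQ] := exists_increasing (erefl #|Q|).
have [q q_incr defQc] := exists_increasing (erefl #|~: Q|).
have qQc t : q t \in ~: Q by rewrite defQc imset_f.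
have gq i t : g i != q t.
  by have := qQc t; rewrite inE; apply: contraNneq => <-; rewrite defQ imset_f.
have def_m : (#|Q| + #|~: Q|)%N = m by rewrite cardsC card_ord.
(* [H] lists the rows in increasing order, those of [A] first. Since j goes to row [rev_ord j] of
   [W0], the complement of [Q] has to be run through backwards, hence the second [rev_ord]. *)
pose H (i : 'I_m) := match split (cast_ord (esym def_m) i) with
  | inl a => lshift m (f a) | inr t => rshift n (rev_ord (q (rev_ord t))) end.
have H_incr : increasing H.
  move=> i j ltij; rewrite /H.
  case: splitP => a /= def_i; case: splitP => b /= def_j.
  - by apply: f_incr; rewrite -def_i -def_j.
  - exact: ltn_addr.
  - move: ltij; rewrite def_i def_j ltnNge.
    by rewrite (leq_trans (ltnW (ltn_ord b))) ?leq_addr.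
  have ltab : (a < b)%N by rewrite -(ltn_add2l #|Q|) -def_i -def_j.
  by rewrite /= ltn_add2l rev_ltn // q_incr //= rev_ltn.
have H_image : rows_of (P, Q) = [set H i | i : 'I_m].
  apply/esym/eqP; rewrite eqEcard card_rows_of // card_imset ?card_ord ?leqnn ?andbT //;
    last exact: increasing_inj.
  apply/subsetP=> _ /imsetP[i _ ->]; rewrite /H inE /=.
  case: split => a.
    by rewrite [X in X || _]imset_f // defP imset_f.
  by rewrite [X in _ || X]imset_f ?orbT.
rewrite H_image plucker_increasing // defP [X in minor A _ X]defQ minor_increasing //.
pose h a := cast_ord def_m (lshift #|~: Q| a).
rewrite (@det_signed_unit_rows #|~: Q| #|Q| m _ h g (fun t => q (rev_ord t))) //.
- congr (\det _); apply/matrixP=> i j; rewrite [RHS]mxE mxE mxE /H /h cast_ordK.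
  by rewrite (unsplitK (inl i) : split (lshift _ i) = inl i) /bar col_mxEu.
- by move=> s t ltst; apply: q_incr; rewrite /= rev_ltn.
move=> t i j def_i; have -> : i = cast_ord def_m (rshift _ t) by apply: val_inj.
rewrite mxE /H cast_ordK (unsplitK (inr t) : split (rshift _ t) = inr t).
rewrite /bar col_mxEd mxE rev_ordK /= subnS; case: eqP => // _; rewrite mulr1n; congr (_ ^+ _); lia.
Qed.

(** With [plucker_rows_of], this makes every maximal minor of [bar A] a minor of [A]. [P] is the
    part of [I] in the upper rows, and the complement of [Q] is the reflected lower part. *)
Lemma rows_of_surj n m (I : {set 'I_(n + m)}) : #|I| = m ->
  exists (P : {set 'I_n}) (Q : {set 'I_m}), #|P| = #|Q| /\ I = rows_of (P, Q).
Proof.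
move=> cardI.
pose P := [set i | lshift m i \in I]; pose Qc := [set j : 'I_m | rshift n (rev_ord j) \in I].
have defI : I = rows_of (P, ~: Qc).
  apply/setP=> x; rewrite /rows_of inE /= setCK -(splitK x).
  case: (split x) => i /=.
    rewrite (mem_imset _ _ (@lshift_inj _ _)) inE.
    case: imsetP => [[j _ /eqP]|_]; last by rewrite orbF.
    by rewrite eq_lrshift.
  rewrite -[i]rev_ordK (mem_imset _ _ (inj_comp (@rshift_inj _ _) rev_ord_inj)) inE.
  by case: imsetP => // -[j _ /eqP]; rewrite eq_rlshift.
exists P, (~: Qc); split=> //.
move: cardI; rewrite {1}defI cardsU /= setCK (card_imset _ (@lshift_inj _ _)).
rewrite (card_imset _ (inj_comp (@rshift_inj _ _) rev_ord_inj)).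
rewrite (_ : _ :&: _ = set0) ?cards0.
  rewrite subn0 => cardPQ; apply/eqP.
  by rewrite -(eqn_add2l #|Qc|) cardsC card_ord addnC cardPQ.
apply/setP=> x; rewrite !inE.
apply/negP=> /andP[/imsetP[a _ ->] /imsetP[b _ /eqP]].
by rewrite eq_lrshift.
Qed.

Lemma plucker_bar_ge0 n m (A : 'M[R]_(n, m)) (I : {set 'I_(n + m)}) :
  totally_nonneg A -> #|I| = m -> 0 <= plucker I (bar A).
Proof.
move=> A_tnn /rows_of_surj[P [Q [eqPQ ->]]].
by rewrite plucker_rows_of // A_tnn.
Qed.

Definition bottom n m : {set 'I_(n + m)} := [set rshift n j | j : 'I_m].

Lemma card_bottom n m : #|bottom n m| = m.
Proof. by rewrite card_imset ?card_ord //; apply: rshift_inj. Qed.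

Lemma plucker_bottom n m (X : 'M[R]_(n + m, m)) :
  plucker (bottom n m) X = \det (dsubmx X).
Proof.
rewrite plucker_increasing => [|i j ltij]; last by rewrite ltn_add2l.
by congr (\det _); apply/matrixP=> i j; rewrite !mxE.
Qed.

Lemma minor_set0 p q (A : 'M[R]_(p, q)) : minor A set0 set0 = 1.
Proof.
have [f f_incr ->] := exists_increasing (cards0 'I_p).
have [g g_incr ->] := exists_increasing (cards0 'I_q).
by rewrite minor_increasing // det_mx00.
Qed.

Lemma rows_of_set0 n m : @rows_of n m (set0, set0) = bottom n m.
Proof.
rewrite /rows_of /= imset0 set0U setC0.
apply/setP=> x; apply/imsetP/imsetP => -[j _ ->]; exists (rev_ord j);
  by rewrite ?inE ?rev_ordK.
Qed.

(** Over a matrix with no rows, [bar] is just [W0], and its bottom coordinate corresponds to the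
    empty minor. *)
Lemma det_W0 m : \det (W0 R m) = 1.
Proof.
rewrite -(minor_set0 (0 : 'M[R]_(0, m))) -plucker_rows_of ?cards0 //.
by rewrite rows_of_set0 plucker_bottom /bar col_mxKd.
Qed.

(** * Rank and nonvanishing maximal minors *)

Lemma plucker_neq0_rank p m (X : 'M[R]_(p, m)) (I : {set 'I_p}) :
  #|I| = m -> plucker I X != 0 -> \rank X = m.
Proof.
move=> /exists_increasing[f f_incr ->]; rewrite plucker_increasing // => nz.
apply/eqP; rewrite eqn_leq rank_leq_col /=.
have rk : \rank (rowsub f X) = m by rewrite mxrank_unit // unitmxE unitfE.
by rewrite -[X in (X <= _)%N]rk rowsubE mxrankM_maxr.
Qed.

Lemma rank_plucker_neq0 p m (X : 'M[R]_(p, m)) : \rank X = m ->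
  exists2 I : {set 'I_p}, #|I| = m & plucker I X != 0.
Proof.
move=> /eqP Xfull; pose f := fullrankfun Xfull.
have cardI : #|[set f i | i : 'I_m]| = m.
  by rewrite card_imset ?card_ord //; apply: fullrankfun_inj.
exists [set f i | i : 'I_m] => //.
have [g g_incr defI] := exists_increasing cardI.
rewrite [in plucker _ _]defI plucker_increasing //.
(* The row selection [f] need not be increasing. Writing it as [g] after [s] makes the invertible
   [rowsub f X] a multiple of [rowsub g X], whose determinant is therefore nonzero. *)
have /fin_all_exists[s fs] i : exists j, f i = g j.
  have : f i \in [set f i | i : 'I_m] by rewrite imset_f.
  by rewrite defI => /imsetP[j _ ->]; exists j.
have : rowsub f X \in unitmx by apply: fullrowsub_unit.
have -> : rowsub f X = rowsub s 1%:M *m rowsub g X.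
  by rewrite -rowsubE; apply/matrixP=> i j; rewrite !mxE fs.
by rewrite unitmxE unitfE det_mulmx mulf_eq0 negb_or => /andP[].
Qed.

(** * Shears of adjacent rows *)

Definition shear p m (e : R) (i0 i1 : 'I_p) (X : 'M[R]_(p, m)) : 'M[R]_(p, m) :=
  \matrix_(r, j) (X r j + e * X i0 j *+ (r == i1)).

(** The determinant is linear in row [i1]. If [i0] is also in [I], the extra determinant has two
    equal rows; otherwise, as the rows are adjacent, putting [i0] in place of [i1] keeps the order
    and produces no sign. *)
Lemma plucker_shear p m (X : 'M[R]_(p, m)) (I : {set 'I_p}) (i0 i1 : 'I_p) (e : R) :
  #|I| = m -> i1 = i0.+1 :> nat ->
  plucker I (shear e i0 i1 X) = plucker I X +
    e * (if (i1 \in I) && (i0 \notin I) then plucker (i0 |: I :\ i1) X else 0).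
Proof.
move=> /exists_increasing[f f_incr ->] def_i1.
have f_inj := increasing_inj f_incr.
rewrite !plucker_increasing //.
case: imsetP => [[a _ def_a]|nI] /=; last first.
  rewrite mulr0 addr0; congr (\det _); apply/matrixP=> r j; rewrite !mxE.
  by case: eqP => [fr|_]; rewrite ?addr0 //; case: nI; exists r.
pose f' r := if r == a then i0 else f r.
rewrite (@determinant_multilinear _ _ _ (rowsub f X) (rowsub f' X) a 1 e).
- rewrite mul1r; congr (_ + e * _).
  case: imsetP => [[b _ def_b]|nI] /=.
    apply: (@determinant_alternate _ _ _ a b).
      by apply: contra_eq_neq def_i1 => eab; rewrite def_a def_b eab; lia.
    by move=> j; rewrite !mxE /f' eqxx; case: eqP => //; rewrite def_b.
  have f'_incr : increasing f'.
    move=> i j ltij; rewrite /f'; have := f_incr _ _ ltij.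
    case: eqP => [->|_]; case: eqP => [->|_] //; rewrite -def_a; try lia.
    by rewrite def_i1 ltnS leq_eqVlt => /orP[/eqP/val_inj fi|//]; case: nI; exists i.
  rewrite -plucker_increasing //; congr plucker; apply/setP=> x.
  rewrite !inE; apply/imsetP/orP => [[r _ ->]|].
    rewrite /f'; case: (r =P a) => [_|/eqP nra]; [by left|right].
    by rewrite def_a (inj_eq f_inj) nra imset_f.
  case=> [/eqP->|/andP[nx /imsetP[r _ def_x]]].
    by exists a; rewrite // /f' eqxx.
  by exists r; rewrite // /f' -(inj_eq f_inj) -def_a -def_x (negPf nx).
- by apply/rowP=> j; rewrite !mxE /f' !eqxx -def_a eqxx mul1r.
- apply/matrixP=> r j; rewrite !mxE def_a (inj_eq f_inj) eq_sym.
  by rewrite (negPf (neq_lift _ _)) addr0.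
- apply/matrixP=> r j; rewrite !mxE def_a (inj_eq f_inj) /f' eq_sym.
  by rewrite (negPf (neq_lift _ _)) addr0.
Qed.

Lemma quadratic_ge0 (a b d : R) :
  (forall e, 0 < e -> 0 <= a + e * b + e ^+ 2 * d) -> 0 <= a.
Proof.
move=> ge0; rewrite leNgt; apply/negP=> a_lt0.
(* If [a < 0], then [0 < e < 1], so the quadratic is at most [a + e * (|b| + |d|) = a + e * (s - 1 +
   a) = - e * (1 - a) < 0]. *)
pose s := `|b| + `|d| + 1 - a; pose e := - a / s.
have s_gt0 : 0 < s by rewrite /s; have := normr_ge0 b; have := normr_ge0 d; lra.
have e_gt0 : 0 < e by rewrite divr_gt0 // oppr_gt0.
have es : e * s = - a by rewrite /e divfK // gt_eqF.
have := ge0 e e_gt0; have := ler_norm b; have := ler_norm d.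
have := normr_ge0 b; have := normr_ge0 d.
rewrite /s in es s_gt0; move: `|b| `|d| es {s_gt0} => x y es; nra.
Qed.

(** * Representatives of a subspace, and the chart where the bottom block is invertible *)

Definition cols p m (X : 'M[R]_(p, m)) : m.-tuple 'cV[R]_p :=
  map_tuple (fun j => col j X) (ord_tuple m).

Lemma sum_cols p m (X : 'M[R]_(p, m)) (u : 'cV[R]_m) :
  X *m u = \sum_(j < m) u j 0 *: (cols X)`_j.
Proof.
apply/colP=> i; rewrite mxE summxE; apply: eq_bigr => j _.
by rewrite -tnth_nth tnth_map tnth_ord_tuple !mxE mulrC.
Qed.

(** The columns of [g] are coordinates of the columns of [Y] with respect to those of [X]. *)
Lemma represents_mulmx p m (X Y : 'M[R]_(p, m)) (V : {vspace 'cV[R]_p}) :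
  represents X V -> represents Y V -> exists g : 'M[R]_m, Y = X *m g.
Proof.
move=> [_ defVX] [_ defVY].
have /fin_all_exists[u Yu] j : exists u : 'cV[R]_m, col j Y = X *m u.
  have : col j Y \in <<cols X>>%VS.
    rewrite -[<<_>>%VS]defVX defVY; apply: memv_span.
    by apply/imageP; exists j.
  move=> /coord_span ->; exists (\col_i coord (cols X) i (col j Y)).
  by rewrite sum_cols; apply: eq_bigr => i _; rewrite mxE.
exists (\matrix_(i, j) u j i 0); apply/matrixP=> i j.
have /colP/(_ i) := Yu j; rewrite !mxE => ->.
by apply: eq_bigr => r _; rewrite mxE.
Qed.

Lemma dim_span_col p m (X : 'M[R]_(p, m)) :
  \rank X = m -> \dim <<[seq col j X | j : 'I_m]>>%VS = m.
Proof.
move=> /eqP Xfull; rewrite -[RHS](size_tuple (cols X)); apply/eqP/(@freeP _ _ _ (cols X)).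
move=> k k0 i; have : X *m (\col_j k j) = X *m 0.
  by rewrite mulmx0 sum_cols -[RHS]k0; apply: eq_bigr => j _; rewrite mxE.
by move=> /(row_full_inj Xfull)/colP/(_ i); rewrite !mxE.
Qed.

(** With bottom block D, matching [W0 *m g = D] forces g to be [W0]^-1 D, and [A] is then the top
    block times the inverse of g. *)
Lemma factor_bar n m (X : 'M[R]_(n + m, m)) :
  dsubmx X \in unitmx ->
  X = bar (usubmx X *m invmx (dsubmx X) *m W0 R m) *m (invmx (W0 R m) *m dsubmx X).
Proof.
move=> uD; have uW : W0 R m \in unitmx by rewrite unitmxE det_W0 unitr1.
rewrite /bar mul_col_mx mulmxA !mulmxA !mulmxK // mulmxV // mul1mx mulmxKV //.
by rewrite vsubmxK.
Qed.

Lemma totally_nonneg_factor n m (A : 'M[R]_(n, m)) (g : 'M[R]_m) :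
  0 < \det g ->
  (forall I : {set 'I_(n + m)}, #|I| = m -> 0 <= plucker I (bar A *m g)) ->
  totally_nonneg A.
Proof.
move=> g_gt0 ge0 P Q eqPQ; have cardI := card_rows_of eqPQ.
by have := ge0 _ cardI; rewrite pluckerM // plucker_rows_of // pmulr_lge0.
Qed.

(** * The quadratic form in Plücker coordinates *)

Section QuadraticForm.
Variables (n m : nat).
Variable S : {set ({set 'I_n} * {set 'I_m}) * ({set 'I_n} * {set 'I_m})}.
Hypothesis S_card :
  forall q, q \in S -> #|q.1.1| = #|q.1.2| /\ #|q.2.1| = #|q.2.2|.
Variable c : ({set 'I_n} * {set 'I_m}) * ({set 'I_n} * {set 'I_m}) -> R.

Let form (X : 'M[R]_(n + m, m)) : R :=
  \sum_(q in S) c q * plucker (rows_of q.1) X * plucker (rows_of q.2) X.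

Let nonneg (X : 'M[R]_(n + m, m)) : Prop :=
  forall I : {set 'I_(n + m)}, #|I| = m -> 0 <= plucker I X.

Let card_rows q : q \in S -> #|rows_of q.1| = m /\ #|rows_of q.2| = m.
Proof. by case: q => [[? ?] [? ?]] /S_card /= [? ?]; rewrite !card_rows_of. Qed.

Lemma form_mulmx (X : 'M[R]_(n + m, m)) (g : 'M[R]_m) :
  form (X *m g) = form X * \det g ^+ 2.
Proof.
rewrite /form mulr_suml; apply: eq_bigr => q /card_rows[c1 c2].
by rewrite !pluckerM //; ring.
Qed.

Lemma form_bar (A : 'M[R]_(n, m)) :
  form (bar A) = \sum_(q in S) c q * minor A q.1.1 q.1.2 * minor A q.2.1 q.2.2.
Proof.
apply: eq_bigr => -[[P1 Q1] [P2 Q2]] /S_card /= [e1 e2].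
by rewrite !plucker_rows_of.
Qed.

(** Each coordinate is affine in [e], so the form is quadratic in [e]. The coefficients are chosen
    before [e], as [quadratic_ge0] requires. *)
Lemma form_shear (X : 'M[R]_(n + m, m)) (i0 i1 : 'I_(n + m)) :
  i1 = i0.+1 :> nat ->
  exists b d, forall e, form (shear e i0 i1 X) = form X + e * b + e ^+ 2 * d.
Proof.
move=> def_i1.
pose s (I : {set 'I_(n + m)}) :=
  if (i1 \in I) && (i0 \notin I) then plucker (i0 |: I :\ i1) X else 0.
exists (\sum_(q in S) c q * (plucker (rows_of q.1) X * s (rows_of q.2)
                              + s (rows_of q.1) * plucker (rows_of q.2) X)).
exists (\sum_(q in S) c q * s (rows_of q.1) * s (rows_of q.2)) => e.
rewrite !mulr_sumr -!big_split /=; apply: eq_bigr => q /card_rows[c1 c2].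
by rewrite !(plucker_shear _ _ _ def_i1) // -/(s _) -/(s _); ring.
Qed.

(** * From condition (2) to all matrices with nonnegative coordinates *)

Hypothesis form_bar_ge0 : forall A : 'M[R]_(n, m), totally_nonneg A -> 0 <= form (bar A).

Lemma form_ge0_bottom (X : 'M[R]_(n + m, m)) :
  nonneg X -> 0 < plucker (bottom n m) X -> 0 <= form X.
Proof.
rewrite plucker_bottom => X_ge0 D_gt0.
have uD : dsubmx X \in unitmx by rewrite unitmxE unitfE gt_eqF.
have g_gt0 : 0 < \det (invmx (W0 R m) *m dsubmx X).
  by rewrite det_mulmx det_inv det_W0 invr1 mul1r.
move: X_ge0; rewrite (factor_bar uD) => /(totally_nonneg_factor g_gt0) A_tnn.
by rewrite form_mulmx mulr_ge0 ?sqr_ge0 // form_bar_ge0.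
Qed.

Lemma shear_nonneg (X : 'M[R]_(n + m, m)) (i0 i1 : 'I_(n + m)) (e : R) :
  i1 = i0.+1 :> nat -> 0 <= e -> nonneg X -> nonneg (shear e i0 i1 X).
Proof.
move=> def_i1 e_ge0 X_ge0 I cardI; rewrite (plucker_shear _ _ cardI def_i1).
rewrite addr_ge0 ?X_ge0 // mulr_ge0 //; case: ifP => // /andP[i1I i0I].
apply: X_ge0; rewrite cardsU1 !inE (negPf i0I) andbF /=.
by move: cardI; rewrite (cardsD1 i1 I) i1I.
Qed.

(** If [I] contained some [x] above the bottom rows, closure under successors would put [x] and all
    [m] bottom rows into [I], which is one element too many. *)
Lemma eq_bottom (I : {set 'I_(n + m)}) : #|I| = m ->
  (forall i0 i1 : 'I_(n + m), i1 = i0.+1 :> nat -> i0 \in I -> i1 \in I) ->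
  I = bottom n m.
Proof.
move=> cardI I_up; apply/eqP; rewrite eqEcard card_bottom cardI leqnn andbT.
apply/subsetP=> x xI; apply: contraT => nx.
have up k (y : 'I_(n + m)) : y = (x + k)%N :> nat -> y \in I.
  elim: k y => [|k IHk] y def_y.
    by rewrite (_ : y = x) //; apply: val_inj; rewrite /= def_y addn0.
  have lt_y : (x + k < n + m)%N by have := ltn_ord y; lia.
  by apply: (I_up (Ordinal lt_y)) => /=; [lia | apply: IHk].
have : (#|x |: bottom n m| <= #|I|)%N.
  apply: subset_leq_card; apply/subsetP=> y; rewrite !inE => /orP[/eqP->//|].
  case/imsetP=> j _ def_y; apply: (up (y - x)%N); rewrite subnKC //.
  have : (x < n)%N.
    rewrite ltnNge; apply: contra nx => le_nx.
    have lt_x : (x - n < m)%N by have := ltn_ord x; lia.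
    by apply/imsetP; exists (Ordinal lt_x) => //; apply: val_inj; rewrite /= subnKC.
  by rewrite def_y /=; lia.
by rewrite cardsU1 nx card_bottom cardI ltnn.
Qed.

(** Induction on the sum of the distances [n + m - i] over [I], for all [X] at once: moving one
    element of [I] to a free next row lowers this sum, and the process stops only at the bottom
    set. *)
Lemma form_ge0_nonneg (X : 'M[R]_(n + m, m)) (I : {set 'I_(n + m)}) :
  #|I| = m -> nonneg X -> 0 < plucker I X -> 0 <= form X.
Proof.
have [k] := ubnP (\sum_(i in I) (n + m - i))%N.
elim: k X I => // k IHk X I; rewrite ltnS => le_k cardI X_ge0 XI_gt0.
have [/existsP[i0 /existsP[i1 /and3P[/eqP def_i1 i0I i1I]]]|none] :=
  boolP [exists i0 : 'I_(n + m), exists i1 : 'I_(n + m),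
           [&& i1 == i0.+1 :> nat, i0 \in I & i1 \notin I]]; last first.
  apply: form_ge0_bottom => //; rewrite -(eq_bottom cardI) // => i0 i1 def_i1 i0I.
  apply: contraNT none => i1I; apply/existsP; exists i0; apply/existsP; exists i1.
  by rewrite def_i1 eqxx i0I.
have ne01 : i1 != i0 by rewrite -val_eqE /= def_i1; lia.
have [b [d form_e]] := form_shear X def_i1.
(* Nonnegativity at [X] follows from that at all its shears with [e > 0], to which the induction
   hypothesis applies with [J]. *)
apply: (@quadratic_ge0 _ b d) => e e_gt0; rewrite -form_e.
pose J := i1 |: I :\ i0.
have i1Ii0 : i1 \notin I :\ i0 by rewrite !inE (negPf i1I) andbF.
have cardJ : #|J| = m by rewrite cardsU1 i1Ii0; move: cardI; rewrite (cardsD1 i0 I) i0I.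
have e_ge0 := ltW e_gt0.
apply: (IHk _ J) => //; last 2 first.
- exact: shear_nonneg.
(* The coordinate [J] of the shear is that of [X] plus [e] times the positive coordinate [I] of
   [X]. *)
- rewrite (plucker_shear _ _ cardJ def_i1).
  have -> : (i1 \in J) && (i0 \notin J) by rewrite !inE !eqxx /= orbF eq_sym.
  have -> : i0 |: J :\ i1 = I by rewrite /J setU1K // setD1K.
  by rewrite ltr_wpDl ?X_ge0 // mulr_gt0.
rewrite (leq_trans _ le_k) // (big_setD1 i0 i0I) /= big_setU1 //= ltn_add2r.
by rewrite def_i1 ltn_sub2l // -def_i1 ltn_ord.
Qed.

End QuadraticForm.
End Minors.

Theorem theorem2p1 (R : realType) (m n : nat) (m_ge1 : (1 <= m)%N) (le_mn : (m <= n)%N)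
    (S : {set ({set 'I_n} * {set 'I_m}) * ({set 'I_n} * {set 'I_m})})
    (S_card : forall q, q \in S -> #|q.1.1| = #|q.1.2| /\ #|q.2.1| = #|q.2.2|)
    (c : ({set 'I_n} * {set 'I_m}) * ({set 'I_n} * {set 'I_m}) -> R) :
  let ineq1 := forall A : 'M[R]_(n, m), totally_nonneg A ->
    0 <= \sum_(q in S) c q * minor A q.1.1 q.1.2 * minor A q.2.1 q.2.2 in
  let ineq2 := forall A : 'M[R]_(n, m), totally_nonneg A ->
    0 <= \sum_(q in S) c q * plucker (rows_of q.1) (bar A) * plucker (rows_of q.2) (bar A) in
  let ineq3 := forall V : {vspace 'cV[R]_(n + m)}, Gr_ge0 m V ->
    forall X : 'M[R]_(n + m, m), represents X V ->
    0 <= \sum_(q in S) c q * plucker (rows_of q.1) X * plucker (rows_of q.2) X in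
  (ineq1 <-> ineq2) /\ (ineq2 <-> ineq3).
Proof.
move=> ineq1 ineq2 ineq3; split; last split.
- by split=> ineq A A_tnn; have := ineq A A_tnn; rewrite form_bar.
- move=> h2 V [_ [X0 [X0V X0_ge0]]] X XV.
  (* The coordinates of [X] may have any sign; only those of [X0] are known to be nonnegative.
     Passing to [X0] costs the factor [\det g ^+ 2]. *)
  have [g ->] := represents_mulmx X0V XV.
  have [I cardI I_neq0] := rank_plucker_neq0 X0V.1.
  rewrite form_mulmx // mulr_ge0 ?sqr_ge0 //.
  by apply: (form_ge0_nonneg S_card h2 cardI X0_ge0); rewrite lt_def I_neq0 X0_ge0.
move=> h3 A A_tnn; pose V := <<[seq col j (bar A) | j : 'I_m]>>%VS.
(* The bottom coordinate of [bar A] is [\det (W0 R m) = 1], so the rank is full for every [A]. *)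
have rk : \rank (bar A) = m.
  apply: (plucker_neq0_rank (card_bottom n m)).
  by rewrite plucker_bottom /bar col_mxKd det_W0 oner_eq0.
have AV : represents (bar A) V by [].
apply: (h3 V) => //; split; first exact: dim_span_col.
by exists (bar A); split=> // I cardI; apply: plucker_bar_ge0.
Qed.
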